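(* Let $n\ge 2$ and $d_1\ge d_2\ge\cdots\ge d_n\ge 2$ be integers, and let $H=\mathbb{C}^{d_1}\otimes\mathbb{C}^{d_2}\otimes\cdots\otimes\mathbb{C}^{d_n}$. If $d_1<\prod_{i=2}^n d_i$, then $H$ contains no stochastic maximum entangled state; that is, there is no $|\phi_0\rangle\in H$ such that $|\phi\rangle\le_{\mathrm{SLOCC}}|\phi_0\rangle$ for every $|\phi\rangle\in H$.
   Context: For states $|\phi\rangle,|\psi\rangle\in H$ (the $i$-th tensor factor being held by party $i$), write $|\psi\rangle\le_{\mathrm{SLOCC}}|\phi\rangle$ if $|\phi\rangle$ can be transformed into $|\psi\rangle$ with nonzero probability by local quantum operations and classical communication; equivalently, there exist linear operators $L_i$ on $\mathbb{C}^{d_i}$ ($i=1,\dots,n$) with $(L_1\otimes\cdots\otimes L_n)|\phi\rangle=|\psi\rangle$. A stochastic maximum entangled state is a state $|\phi_0\rangle$ with $|\phi\rangle\le_{\mathrm{SLOCC}}|\phi_0\rangle$ for all $|\phi\rangle\in H$. *)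

(* Defs.v *)
From HB Require Import structures.
From mathcomp Require Import all_boot all_order all_algebra.
Set Implicit Arguments. Unset Strict Implicit. Unset Printing Implicit Defensive.
Import Order.TTheory GRing.Theory Num.Theory.
Local Open Scope ring_scope.

Definition mindex (n : nat) (d : 'I_n -> nat) : finType :=
  {dffun forall i : 'I_n, 'I_(d i)}.

(* A vector of H = C^{d_1} (x) ... (x) C^{d_n}, given by its coordinates
   in the product basis |j_1 ... j_n>. *)
Definition state (R : numClosedFieldType) (n : nat) (d : 'I_n -> nat) :=
  {ffun mindex d -> R}.

(* (L_1 (x) ... (x) L_n) applied to phi. *)
Definition local_apply (R : numClosedFieldType) (n : nat) (d : 'I_n -> nat)
  (L : forall i : 'I_n, 'M[R]_(d i)) (phi : state R d) : state R d :=
  [ffun j : mindex d =>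
     \sum_(k : mindex d) (\prod_(i : 'I_n) L i (j i) (k i)) * phi k].

Definition slocc_le (R : numClosedFieldType) (n : nat) (d : 'I_n -> nat)
  (psi phi : state R d) : Prop :=
  exists L : forall i : 'I_n, 'M[R]_(d i), local_apply L phi = psi.

Definition stoch_max_entangled (R : numClosedFieldType) (n : nat)
  (d : 'I_n -> nat) (phi0 : state R d) : Prop :=
  forall phi : state R d, slocc_le phi phi0.

(* Main.v *)
(** Write party 0 as the largest one, a = d 0 and s = \sum_(i != 0) (d i - 1).
    If phi0 is stochastically maximal, the operators that carry it to a state
    of full local ranks are invertible, so every such state is maximal as well.
    One such state is psi = \sum_(j < a) |j> |g_j>, where the multi-indices g_j
    of the other parties are pairwise distinct and cover every coordinate.
    It is not maximal: it cannot be converted into the state phi which sums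
    all |k_0 k_1 ... > with k_0 = \sum_(i != 0) k_i, the multiplication of
    polynomials of degrees less than d i, truncated below degree a.
    If s < a, nothing is truncated, so no product vector of the other parties
    annihilates phi, whereas a multi-index missed by g annihilates psi.
    If a <= s, the functionals of party 0 that map psi to a product span C^a,
    whereas those that map phi to a product form a line: w_(k_1 + ...) is a
    product only if w_(t+1)^2 = w_t w_(t+2), which propagates the vanishing of
    w at a down to w_1. *)
Require Import Defs.
From HB Require Import structures.
From mathcomp Require Import all_boot all_order all_algebra.
Import Order.TTheory GRing.Theory Num.Theory.
Set Implicit Arguments. Unset Strict Implicit. Unset Printing Implicit Defensive.
Local Open Scope ring_scope.

Lemma bigA_distr_dffun (R : comPzSemiRingType) (I : finType) (T : I -> finType)
    (F : forall i, T i -> R) :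
  \prod_i \sum_(j : T i) F i j
    = \sum_(f : {dffun forall i, T i}) \prod_i F i (f i).
Proof.
under eq_bigr => i _ do rewrite (big_tag F i).
rewrite bigA_distr_big_dep.
rewrite (reindex (@dffun_of_fprod _ T)); last exact/onW_bij/dffun_of_fprod_bij.
transitivity (\sum_(t : fprod T) \prod_i [ffun j => F i j] (t i)).
  rewrite (big_fprod_dep _ _ _ predT); apply: eq_big => [g|g _].
    by rewrite andbT.
  apply: eq_bigr => i _; rewrite /untag; case: eqP => // e.
  by rewrite ffunE.
by apply: eq_bigr => t _; apply: eq_bigr => i _; rewrite !ffunE.
Qed.

Lemma unitmx_inj (F : fieldType) m (A : 'M[F]_m) :
  (forall v : 'rV_m, v *m A = 0 -> v = 0) -> A \in unitmx.
Proof. by rewrite -row_free_unit; apply: inj_row_free. Qed.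

Lemma dfwith_neq (I : eqType) (T : I -> Type) (f : forall i, T i) i (a : T i) j :
  j != i -> dfwith f a j = f j.
Proof. by rewrite eq_sym; apply: dfwith_out. Qed.

(** * States as multilinear forms, and the effect of local operators on them *)

Section Eval.
Variables (R : numClosedFieldType) (n : nat) (d : 'I_n -> nat).
Implicit Types (phi psi : state R d) (x : forall i, 'rV[R]_(d i)).
Implicit Types (k m : mindex d) (L : forall i, 'M[R]_(d i)).

(** The bilinear pairing, without conjugation, of [phi] with the product vector of the rows
    [x i]. *)
Definition ev phi x : R := \sum_(k : mindex d) (\prod_i x i 0 (k i)) * phi k.

Definition bvec k : forall i, 'rV[R]_(d i) := fun i => delta_mx 0 (k i).

Lemma eq_ev phi x y : (forall i, x i = y i) -> ev phi x = ev phi y.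
Proof.
move=> exy; apply: eq_bigr => k _; congr (_ * _).
by apply: eq_bigr => i _; rewrite exy.
Qed.

(** By distributivity the operators move into the slots, so a conversion of states becomes a linear
    substitution in each argument. *)
Lemma ev_local_apply L phi x :
  ev (local_apply L phi) x = ev phi (fun i => x i *m L i).
Proof.
rewrite /ev; under eq_bigr => j _ do rewrite ffunE big_distrr /=.
rewrite exchange_big /=; apply: eq_bigr => k _.
under [X in _ = X * _]eq_bigr => i _ do rewrite mxE.
rewrite bigA_distr_dffun big_distrl /=; apply: eq_bigr => j _.
by rewrite mulrA big_split.
Qed.

Lemma ev_eq0 phi x i : x i = 0 -> ev phi x = 0.
Proof.
move=> xi0; apply: big1 => k _.
by rewrite (bigD1 i) //= xi0 mxE !mul0r.
Qed.

(** Injectivity of the flattening of [phi] at party [i]: this flattening has rank [d i]. *)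
Definition full_local_rank phi i :=
  forall v : 'rV[R]_(d i),
    (forall x, ev phi (dfwith x v) = 0) -> v = 0.

(** A row killed by [L i] is a functional of party [i] that annihilates the image state. *)
Lemma full_local_rank_unitmx L phi i :
  full_local_rank (local_apply L phi) i -> L i \in unitmx.
Proof.
move=> Fi; apply: unitmx_inj => v vL0; apply: Fi => x.
by rewrite ev_local_apply; apply: (@ev_eq0 _ _ i); rewrite dfwith_in.
Qed.

(** The operators [L] from [phi0] to [psi] can be undone; following their inverses by the operators
    [M] from [phi0] to [phi] converts [psi] into [phi]. *)
Lemma stoch_max_full_local_rank phi0 psi phi :
  stoch_max_entangled phi0 -> (forall i, full_local_rank psi i) ->
  exists C : forall i, 'M[R]_(d i),
    forall x, ev phi x = ev psi (fun i => x i *m C i).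
Proof.
move=> max0 Fpsi; have [L eL] := max0 psi; have [M eM] := max0 phi.
exists (fun i => M i *m invmx (L i)) => x.
rewrite -eM -eL !ev_local_apply; apply: eq_ev => i.
rewrite mulmxA mulmxKV //; apply: (@full_local_rank_unitmx L phi0).
by rewrite eL; apply: Fpsi.
Qed.


Definition upd k i (c : 'I_(d i)) : mindex d := [ffun j => dfwith k c j].

Lemma upd_in k i (c : 'I_(d i)) : upd k c i = c.
Proof. by rewrite ffunE dfwith_in. Qed.

Lemma upd_out k i (c : 'I_(d i)) j : j != i -> upd k c j = k j.
Proof. by move=> ji; rewrite ffunE dfwith_neq. Qed.

Lemma ev_dfwith_bvec phi k i (v : 'rV[R]_(d i)) :
  ev phi (dfwith (bvec k) v) = \sum_c v 0 c * phi (upd k c).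
Proof.
(* The test says that [k'] agrees with [k] off [i]; any other [k'] meets a zero entry of
   [bvec k]. *)
rewrite /ev (bigID (fun k' => k' == upd k (k' i))) /= [X in _ + X]big1 => [|k'].
  rewrite addr0 (reindex_onto (fun c => upd k c) (fun k' => k' i)) /=; last first.
    by move=> k' /eqP <-.
  apply: eq_big => [c|c _]; first by rewrite upd_in !eqxx.
  congr (_ * _); rewrite (bigD1 i) //= dfwith_in upd_in big1 ?mulr1 // => j ji.
  by rewrite upd_out // dfwith_neq // mxE !eqxx.
move=> neq; suff [j ji nkj] : exists2 j, j != i & k j != k' j.
  by rewrite (bigD1 j) //= dfwith_neq // mxE eq_sym (negPf nkj) andbF !mul0r.
apply/exists_inP; apply: contraNT neq => /exists_inPn H; apply/eqP/ffunP => j.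
have [->|ji] := eqVneq j i; first by rewrite upd_in.
by rewrite upd_out //; move: (H j ji); rewrite negbK => /eqP.
Qed.

Variable i0 : 'I_n.

(** * Sums of basis vectors over the graph of an injection *)

Section Graph.
Variable g : 'I_(d i0) -> mindex d.
Hypothesis g_i0 : forall j, g j i0 = j.
Hypothesis g_inj : forall j j', (forall i, i != i0 -> g j i = g j' i) -> j = j'.

(** The sum of the basis vectors [g j]: since [g j] has coordinate [j] at [i0], only [g (k i0)] can
    equal [k]. *)
Definition graph_state : state R d := [ffun k : mindex d => (k == g (k i0))%:R].

Lemma ev_graph_state x :
  ev graph_state x = \sum_j \prod_i x i 0 (g j i).
Proof.
rewrite /ev; under eq_bigr => k _ do rewrite ffunE mulr_natr mulrb.
rewrite -big_mkcond /= (reindex_onto g (fun k => k i0)) /=; last first.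
  by move=> k /eqP <-.
by apply: eq_bigl => j; rewrite g_i0 !eqxx.
Qed.

(** Two members of the graph never differ in exactly one slot: at [i0] this is [g_inj], and
    elsewhere the coordinate at [i0] determines the member. *)
Lemma graph_state_upd j i (c : 'I_(d i)) :
  graph_state (upd (g j) c) = (c == g j i)%:R.
Proof.
rewrite ffunE; congr (_ %:R : R); congr nat_of_bool.
have [ei|ni] := eqVneq i i0.
  move: c; rewrite {}ei => c; rewrite upd_in g_i0; apply/eqP/eqP => [e|->].
    by apply: g_inj => l nl; rewrite -e upd_out.
  apply/ffunP => l; have [->|nl] := eqVneq l i0; first by rewrite upd_in g_i0.
  by rewrite upd_out.
have ni' : i0 != i by rewrite eq_sym.
rewrite upd_out // g_i0; apply/eqP/eqP => [e|->].
  by rewrite -e upd_in.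
apply/ffunP => l; have [->|nl] := eqVneq l i; first by rewrite upd_in.
by rewrite upd_out.
Qed.

(** Putting [bvec (g j)] in the other slots isolates coordinate [g j i] of [v]. *)
Lemma graph_state_full_local_rank i :
  (forall c, exists j, g j i = c) -> full_local_rank graph_state i.
Proof.
move=> g_surj v v0; apply/rowP => c; have [j <-] := g_surj c.
move: (v0 (bvec (g j))); rewrite ev_dfwith_bvec (bigD1 (g j i)) //=.
rewrite graph_state_upd eqxx mulr1 big1 ?addr0 ?mxE // => c' nc'.
by rewrite graph_state_upd (negPf nc') mulr0.
Qed.

Lemma ev_graph_state_missing m (w : 'rV[R]_(d i0)) :
  (forall j, exists2 i, i != i0 & g j i != m i) ->
  ev graph_state (dfwith (bvec m) w) = 0.
Proof.
move=> m_miss; rewrite ev_dfwith_bvec big1 // => c _.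
rewrite ffunE upd_in; have [i ni ngm] := m_miss c.
rewrite (_ : _ == _ = false) ?mulr0 //; apply: contraNF ngm => /eqP <-.
by rewrite upd_out.
Qed.

Lemma ev_graph_state_slice x c :
  x i0 = delta_mx 0 c ->
  ev graph_state x = \prod_(i | i != i0) x i 0 (g c i).
Proof.
move=> xi0; rewrite ev_graph_state (bigD1 c) //= [X in _ + X]big1 => [|j nj].
  by rewrite addr0 (bigD1 i0) //= xi0 g_i0 mxE !eqxx mul1r.
by rewrite (bigD1 i0) //= xi0 g_i0 mxE (negPf nj) andbF mul0r.
Qed.

End Graph.

(** * Truncated polynomial multiplication as a state *)

Definition wt k : nat := \sum_(i | i != i0) k i.

Definition degree_state : state R d :=
  [ffun k : mindex d => (k i0 == wt k :> nat)%:R].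

Lemma wt_upd k (c : 'I_(d i0)) : wt (upd k c) = wt k.
Proof. by apply: eq_bigr => i ni; rewrite upd_out. Qed.

(** The sum has at most one term, coordinate [wt k] of [v]; it is empty once [wt k] reaches [d i0],
    which is the truncation. *)
Lemma ev_degree_state_bvec k (v : 'rV[R]_(d i0)) :
  ev degree_state (dfwith (bvec k) v) = \sum_(c < d i0 | c == wt k :> nat) v 0 c.
Proof.
rewrite ev_dfwith_bvec [RHS]big_mkcond; apply: eq_bigr => c _.
by rewrite ffunE upd_in wt_upd mulr_natr mulrb.
Qed.

(* The product of the lowest nonzero coordinates is the coefficient of lowest
   degree of the product of the polynomials encoded by the [x i]. *)
Lemma degree_state_no_zero x :
  (\sum_(i | i != i0) (d i).-1 < d i0)%N ->
  (forall i, i != i0 -> x i != 0) ->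
  exists w : 'rV[R]_(d i0), ev degree_state (dfwith x w) != 0.
Proof.
move=> lt_s nx.
have low i : exists t : 'I_(d i), (i != i0) ->
    x i 0 t != 0 /\ forall c, x i 0 c != 0 -> (t <= c)%N.
  have [ei|ni] := eqVneq i i0.
    by rewrite {}ei; exists (Ordinal (leq_ltn_trans (leq0n _) lt_s)).
  have /rV0Pn[c xc] := nx i ni.
  by case: (@arg_minnP _ c (fun c => x i 0 c != 0) val xc) => t xt tmin; exists t.
have [t tP] := fin_all_exists low.
have lt_t : (\sum_(i | i != i0) t i < d i0)%N.
  apply: leq_ltn_trans lt_s; apply: leq_sum => i _.
  by rewrite -ltnS (leq_trans (ltn_ord _)) // leqSpred.
pose T := Ordinal lt_t; exists (delta_mx 0 T).
pose k : mindex d := [ffun i => dfwith t T i].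
have ki i : i != i0 -> k i = t i by move=> ni; rewrite ffunE dfwith_neq.
have ki0 : k i0 = T by rewrite ffunE dfwith_in.
have wk : wt k = T by apply: eq_bigr => i ni; rewrite ki.
rewrite /ev (bigD1 k) //= [X in _ + X]big1 => [|k' nk'].
  rewrite addr0 [degree_state k]ffunE ki0 wk eqxx mulr1.
  apply/prodf_neq0 => i _; have [->|ni] := eqVneq i i0.
    by rewrite ki0 dfwith_in mxE !eqxx oner_eq0.
  by rewrite ki // dfwith_neq //; case: (tP i ni).
(* A surviving [k'] has coordinates at least [t i] with the same total [T], hence it is [k]. *)
apply/eqP; apply: contraNT nk'; rewrite mulf_eq0 negb_or => /andP[/prodf_neq0 H].
rewrite ffunE pnatr_eq0 eqb0 negbK => /eqP wk'.
have k'i0 : k' i0 = T.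
  move: (H i0 isT); rewrite dfwith_in mxE eqxx /=.
  by rewrite pnatr_eq0 eqb0 negbK => /eqP.
have le_tk i : i != i0 -> (t i <= k' i)%N.
  by move=> ni; apply: (tP i ni).2; move: (H i isT); rewrite dfwith_neq.
have : (\sum_(i | i != i0) t i == \sum_(i | i != i0) k' i)%N.
  by rewrite -/(wt k') -wk' k'i0.
rewrite (leqif_sum (fun i ni => leqif_eq (le_tk i ni))).2 => /forall_inP eqt.
apply/eqP/ffunP => i; have [->|ni] := eqVneq i i0.
  by rewrite k'i0 ki0.
by rewrite ki //; apply/val_inj/esym/eqP/eqt.
Qed.

(** Starting from zero, some coordinate below its cap [c i] can be raised by one until the weight is
    [t]. *)
Lemma wt_attained (c : 'I_n -> nat) (t : nat) :
  (forall i, c i < d i)%N -> (t <= \sum_(i | i != i0) c i)%N ->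
  exists2 k, wt k = t & forall i, i != i0 -> (k i <= c i)%N.
Proof.
move=> ltcd; elim: t => [_|t IHt lt_t].
  exists [ffun i => Ordinal (leq_ltn_trans (leq0n _) (ltcd i))] => [|i _].
    by rewrite /wt big1 // => i _; rewrite ffunE.
  by rewrite ffunE.
have [k wk lek] := IHt (ltnW lt_t).
have /exists_inP[i ni ltkc] : [exists (i | i != i0), k i < c i]%N.
  apply: contraTT lt_t => /exists_inPn H; rewrite -leqNgt -wk.
  by apply: leq_sum => i ni; rewrite leqNgt H.
exists (upd k (Ordinal (leq_ltn_trans ltkc (ltcd i)))) => [|j nj].
  rewrite /wt (bigD1 i) //= upd_in -wk /wt (bigD1 i ni) /= addSn.
  by congr (_ + _).+1; apply: eq_bigr => j /andP[_ nj]; rewrite upd_out.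
have [->|nji] := eqVneq j i; first by rewrite upd_in.
by rewrite upd_out ?lek.
Qed.

(** * Functionals that turn truncated multiplication into a product *)

Section ProductFunctional.
Variables (i1 i2 : 'I_n).
Hypotheses (ni1 : i1 != i0) (ni2 : i2 != i0) (ni21 : i2 != i1).
Hypothesis d_gt1 : forall i, (1 < d i)%N.
Variables (w : nat -> R) (l : forall i, 'I_(d i) -> R).
Hypothesis w_prod : forall k, w (wt k) = \prod_(i | i != i0) l (k i).

(** Take [k] of weight [t] and raise it at [i1], at [i2], or at both: the product of the two single
    raises has the same factors as the product of none and both. *)
Lemma product_functional_geometric t :
  (t.+1 < \sum_(i | i != i0) (d i).-1)%N -> w t.+1 ^+ 2 = w t * w t.+2.
Proof.
(* The caps at [i1] and [i2] are lowered by one to leave room for the raises. *)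
pose c i := ((d i).-1 - ((i == i1) || (i == i2)))%N.
have lecd i : (c i <= (d i).-1)%N by exact: leq_subr.
have sumc : (\sum_(i | i != i0) (d i).-1 = (\sum_(i | i != i0) c i).+2)%N.
  rewrite (bigD1 i1) // (bigD1 i2) ?ni2 //= [in RHS](bigD1 i1) //.
  rewrite [in RHS](bigD1 i2) ?ni2 //= /c !eqxx orbT !subn1 (eq_bigr c) => [|i].
    rewrite /c; case: (d i1) (d_gt1 i1) => [|[|a]] // _.
    by case: (d i2) (d_gt1 i2) => [|[|b]] //= _; rewrite !addSn !addnS.
  by move=> /andP[/andP[_ /negPf n1] /negPf n2]; rewrite /c n1 n2 subn0.
rewrite sumc !ltnS => le_t.
have ltcd i : (c i < d i)%N by rewrite -(ltn_predK (d_gt1 i)) ltnS.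
have [k wk lek] := wt_attained ltcd le_t.
pose r := (\sum_(i | (i != i0) && (i != i1) && (i != i2)) k i)%N.
pose Q := \prod_(i | (i != i0) && (i != i1) && (i != i2)) l (k i).
have wE (a : 'I_(d i1)) (b : 'I_(d i2)) : w (a + (b + r))%N = l a * (l b * Q).
  have n12 : i1 != i2 by rewrite eq_sym.
  have := w_prod (upd (upd k a) b).
  rewrite /wt (bigD1 i1) // (bigD1 i2) ?ni2 //= [in RHS](bigD1 i1) //.
  rewrite [in RHS](bigD1 i2) ?ni2 //= upd_in upd_out // upd_in.
  rewrite (eq_bigr (fun i => nat_of_ord (k i))) => [|i]; last first.
    by move=> /andP[/andP[_ n1] n2]; rewrite !upd_out.
  move=> ->; congr (_ * (_ * _)); apply: eq_bigr => i.
  by move=> /andP[/andP[_ n1] n2]; rewrite !upd_out.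
have lt1 : ((k i1).+1 < d i1)%N.
  have := lek i1 ni1; rewrite /c eqxx subn1 -ltnS => /leq_ltn_trans; apply.
  by case: (d i1) (d_gt1 i1) => [|[|a]] /=.
have lt2 : ((k i2).+1 < d i2)%N.
  have := lek i2 ni2; rewrite /c eqxx orbT subn1 -ltnS => /leq_ltn_trans; apply.
  by case: (d i2) (d_gt1 i2) => [|[|a]] /=.
have tE : t = (k i1 + (k i2 + r))%N.
  by rewrite -wk /wt (bigD1 i1) // (bigD1 i2) ?ni2.
have := wE (k i1) (k i2); rewrite -tE => ->.
have := wE (Ordinal lt1) (Ordinal lt2); rewrite /= !addSn !addnS -tE => ->.
rewrite expr2; have := wE (Ordinal lt1) (k i2); rewrite /= addSn -tE => {1}->.
have := wE (k i1) (Ordinal lt2); rewrite /= addSn addnS -tE => ->.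
by rewrite mulrACA [_ * l (k i1)]mulrC -mulrACA.
Qed.

(** A zero at [t.+2] forces a zero square at [t.+1]. The descent stops at 1, as index 0 is never a
    middle term. *)
Lemma product_functional_vanishes a :
  (a <= \sum_(i | i != i0) (d i).-1)%N ->
  (forall t, (a <= t)%N -> w t = 0) -> forall t, w t.+1 = 0.
Proof.
move=> le_as w0.
suff H b t : (a <= t.+1 + b)%N -> w t.+1 = 0.
  by move=> t; apply: (H a); rewrite leq_addl.
elim: b t => [|b IHb] t lea; first by apply: w0; rewrite addn0 in lea.
have [/w0 //|lta] := leqP a t.+1.
apply/eqP; rewrite -sqrf_eq0 product_functional_geometric ?(leq_trans lta) //.
by rewrite IHb ?mulr0 // addSnnS.
Qed.

End ProductFunctional.

(** * The degree state is not obtained from a graph state *)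

Section Separation.
Variable g : 'I_(d i0) -> mindex d.
Hypothesis g_i0 : forall j, g j i0 = j.
Hypothesis g_inj : forall j j', (forall i, i != i0 -> g j i = g j' i) -> j = j'.
Hypothesis d_gt1 : forall i, (1 < d i)%N.
Variable C : forall i, 'M[R]_(d i).
Hypothesis evC :
  forall x, ev degree_state x = ev (graph_state g) (fun i => x i *m C i).

(** A kernel vector of [C i] would give a product of nonzero vectors annihilating the degree state,
    so [C i] is invertible for [i != i0]; pulling [bvec m] back through it gives such a product
    again. *)
Lemma degree_not_graph_wide m :
  (\sum_(i | i != i0) (d i).-1 < d i0)%N ->
  (forall j, exists2 i, i != i0 & g j i != m i) -> False.
Proof.
move=> lt_s m_miss.
have Cunit i : i != i0 -> C i \in unitmx.
  move=> ni; apply: unitmx_inj => v vC0; apply/eqP/contraT => nv.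
  pose x := dfwith (fun j => const_mx 1 : 'rV[R]_(d j)) v.
  have nx j : j != i0 -> x j != 0.
    move=> _; have [->|nj] := eqVneq j i; first by rewrite /x dfwith_in.
    rewrite /x dfwith_neq //; apply/rV0Pn; exists (Ordinal (ltnW (d_gt1 j))).
    by rewrite mxE oner_neq0.
  have [u] := degree_state_no_zero lt_s nx.
  by rewrite evC (@ev_eq0 _ _ i) ?eqxx // dfwith_neq // /x dfwith_in.
pose y i := bvec m i *m invmx (C i).
have yC i : i != i0 -> y i *m C i = bvec m i by move=> ni; rewrite mulmxKV ?Cunit.
have ny i : i != i0 -> y i != 0.
  move=> ni; apply: contraNneq (oner_neq0 R) => y0.
  have /rowP/(_ (m i)) := yC i ni.
  by rewrite y0 mul0mx !mxE !eqxx /= => /esym/eqP.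
have [u] := degree_state_no_zero lt_s ny; rewrite evC => /eqP; apply.
rewrite -(ev_graph_state_missing (u *m C i0) m_miss); apply: eq_ev => i.
have [->|ni] := eqVneq i i0; first by rewrite !dfwith_in.
by rewrite !dfwith_neq // yC.
Qed.

(** Each row of the inverse of [C i0] sends the degree state to a product, so its coordinate 1
    vanishes; an invertible matrix has no zero column. *)
Lemma degree_not_graph_narrow (i1 i2 : 'I_n) :
  i1 != i0 -> i2 != i0 -> i2 != i1 ->
  (d i0 <= \sum_(i | i != i0) (d i).-1)%N -> False.
Proof.
move=> ni1 ni2 ni21 le_s.
have sum_coord (v : 'rV[R]_(d i0)) (c : 'I_(d i0)) :
      \sum_(c' < d i0 | c' == c :> nat) v 0 c' = v 0 c.
  exact: big_pred1_eq.
have Cunit : C i0 \in unitmx.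
  (* Every [c] below [d i0] is the weight of some [k], so the degree state sees each coordinate of
     [v]. *)
  apply: unitmx_inj => v vC0; apply/rowP => c; rewrite mxE -sum_coord.
  have ltd i : ((d i).-1 < d i)%N by rewrite (ltn_predK (d_gt1 i)).
  have [k <- _] := wt_attained ltd (leq_trans (ltnW (ltn_ord c)) le_s).
  by rewrite -ev_degree_state_bvec evC (@ev_eq0 _ _ i0) // dfwith_in.
pose B := invmx (C i0); pose c1 := Ordinal (d_gt1 i0).
have B0 c : B c c1 = 0.
  (* [w] extends [v] by zero from [d i0] on; [C i0] maps [v] to the basis row at [c]. *)
  pose v := row c B; pose w (t : nat) := \sum_(c' < d i0 | c' == t :> nat) v 0 c'.
  pose l i (b : 'I_(d i)) := C i b (g c i).
  have w_prod k : w (wt k) = \prod_(i | i != i0) l i (k i).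
    rewrite /w -ev_degree_state_bvec evC (ev_graph_state_slice g_i0 (c := c)).
      apply: eq_bigr => i ni; rewrite dfwith_neq // /bvec -rowE.
      by rewrite mxE.
    by rewrite dfwith_in /v rowE mulmxKV.
  have w0 t : (d i0 <= t)%N -> w t = 0.
    move=> le_t; apply: big_pred0 => c'.
    by rewrite ltn_eqF // (leq_trans (ltn_ord c')).
  have := product_functional_vanishes ni1 ni2 ni21 d_gt1 w_prod le_s w0 0.
  by rewrite /w (sum_coord v c1) mxE.
have /matrixP/(_ c1 c1) := mulmxV Cunit.
rewrite !mxE eqxx big1 => [/esym/eqP|c _]; first by rewrite oner_eq0.
by rewrite -/B B0 mulr0.
Qed.

End Separation.

(** List the multi-indices of the other parties, diagonal ones first to cover all coordinates. The
    first [d i0] entries define [g], and the next one is [m]. *)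
Lemma exists_graph :
  (forall i, 0 < d i)%N -> (forall i, d i <= d i0)%N ->
  (d i0 < \prod_(i | i != i0) d i)%N ->
  exists (g : 'I_(d i0) -> mindex d) m,
    [/\ forall j, g j i0 = j,
        forall j j', (forall i, i != i0 -> g j i = g j' i) -> j = j',
        forall i c, exists j, g j i = c
      & forall j, exists2 i, i != i0 & g j i != m i].
Proof.
move=> d_gt0 le_d lt_d.
pose z i : 'I_(d i) := Ordinal (d_gt0 i).
(* Freezing the coordinate at [i0] to zero makes [A] a copy of the multi-indices of the other
   parties. *)
pose F i : pred 'I_(d i) := [pred c | (i == i0) ==> (c == z i)].
pose A : {pred mindex d} := family F.
have AP k k' : k \in A -> k' \in A -> (forall i, i != i0 -> k i = k' i) -> k = k'.
  move=> /familyP Ak /familyP Ak' ekk'; apply/ffunP => i.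
  have [ei|/ekk' //] := eqVneq i i0.
  have := Ak i; have := Ak' i; rewrite !inE ei eqxx /=.
  by rewrite -ei => /eqP-> /eqP->.
have cardA : #|A| = (\prod_(i | i != i0) d i)%N.
  rewrite card_family foldrE big_image /= (bigD1 i0) //=.
  rewrite (eq_card (B := pred1 (z i0))) ?card1 ?mul1n => [|c]; last first.
    by rewrite !inE eqxx.
  apply: eq_bigr => i ni; rewrite -[RHS]card_ord; apply: eq_card => c.
  by rewrite !inE (negPf ni).
(* Coordinates where [c] is out of range default to zero, so diagonals may coincide; hence [undup]
   below. *)
pose diag (c : nat) : mindex d := [ffun i => if i == i0 then z i else insubd (z i) c].
have diagA c : diag c \in A.
  by apply/familyP => i; rewrite !inE ffunE; case: eqP => //= _; rewrite eqxx.
pose T := undup [seq diag c | c : 'I_(d i0)].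
have sizeT : (size T <= d i0)%N.
  by rewrite (leq_trans (size_undup _)) // size_image card_ord.
pose s := T ++ [seq k <- enum A | k \notin T].
have mem_s : s =i A.
  move=> k; rewrite mem_cat mem_filter mem_enum.
  have [Tk|//] := boolP (k \in T).
  by move: Tk; rewrite mem_undup => /imageP[c _ ->]; rewrite diagA.
have uniq_s : uniq s.
  rewrite cat_uniq undup_uniq filter_uniq ?enum_uniq // andbT /=.
  by apply/hasPn => k; rewrite mem_filter => /andP[].
have size_s : size s = #|A| by rewrite -(card_uniqP uniq_s); apply: eq_card.
have lt_s : (d i0 < size s)%N by rewrite size_s cardA.
pose h j := nth (diag 0) s j.
have hA j : (j <= d i0)%N -> h j \in A.
  by move=> lej; rewrite -mem_s mem_nth // (leq_ltn_trans lej).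
have h_inj j j' : (j <= d i0)%N -> (j' <= d i0)%N ->
    (forall i, i != i0 -> h j i = h j' i) -> j = j'.
  move=> lej lej' /(AP _ _ (hA _ lej) (hA _ lej')) /eqP.
  by rewrite nth_uniq ?(leq_ltn_trans _ lt_s) // => /eqP.
exists (fun j : 'I_(d i0) => upd (h j) j), (h (d i0)); split.
- by move=> j; rewrite upd_in.
- move=> j j' H; apply/val_inj/h_inj; rewrite ?(ltnW (ltn_ord _)) // => i ni.
  by have := H i ni; rewrite !upd_out.
- move=> i c; have [ei|ni] := eqVneq i i0.
    by move: c; rewrite ei => c; exists c; rewrite upd_in.
  have Tc : diag c \in T.
    rewrite mem_undup; apply/imageP.
    by exists (Ordinal (leq_trans (ltn_ord c) (le_d i))).
  have ltj : (index (diag c) s < d i0)%N.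
    by rewrite index_cat Tc (leq_trans _ sizeT) // index_mem.
  exists (Ordinal ltj); rewrite upd_out // /h nth_index ?mem_cat ?Tc //.
  by rewrite ffunE (negPf ni); apply/val_inj; rewrite val_insubd ltn_ord.
- move=> j; apply/exists_inP; apply: contraT => /exists_inPn H.
  have := @h_inj j (d i0) (ltnW (ltn_ord j)) (leqnn _) _.
  move=> /(_ _)/eqP; rewrite ltn_eqF ?ltn_ord //; apply=> i ni.
  by have := H i ni; rewrite negbK upd_out // => /eqP.
Qed.

End Eval.

Theorem theorem1 (R : numClosedFieldType) (n : nat) (d : 'I_n -> nat) :
  (2 <= n)%N ->
  (forall i : 'I_n, (2 <= d i)%N) ->
  (forall i j : 'I_n, (i <= j)%N -> (d j <= d i)%N) ->
  (forall i0 : 'I_n, nat_of_ord i0 = 0%N ->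
     (d i0 < \prod_(i : 'I_n | nat_of_ord i != 0%N) d i)%N) ->
  ~ (exists phi0 : state R d, stoch_max_entangled phi0).
Proof.
move=> n_gt1 d_gt1 d_mono d_lt [phi0 max0].
pose i0 := Ordinal (ltnW n_gt1); pose i1 := Ordinal n_gt1.
have {}d_lt : (d i0 < \prod_(i | i != i0) d i)%N by exact: d_lt.
have le_d i : (d i <= d i0)%N by exact: d_mono.
(* With two parties the product would be [d i1], which is at most [d i0]. *)
have n_gt2 : (2 < n)%N.
  rewrite ltnNge; apply: contraTN d_lt => n_le2; rewrite -leqNgt (bigD1 i1) //=.
  rewrite big1 ?muln1 // => i /andP[n0 n1]; case/negP: n1.
  move: n0; rewrite -!val_eqE /=.
  by case: i => [[|[|i]] lti] //=; have := leq_trans lti n_le2.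
pose i2 := Ordinal n_gt2.
have [g [m [g_i0 g_inj g_surj m_miss]]] :=
  exists_graph (fun i => ltnW (d_gt1 i)) le_d d_lt.
have [C evC] := stoch_max_full_local_rank (degree_state R d i0) max0
  (fun i => graph_state_full_local_rank g_i0 g_inj (g_surj i)).
have [le_s|lt_s] := leqP (d i0) (\sum_(i | i != i0) (d i).-1).
  exact: (degree_not_graph_narrow g_i0 d_gt1 evC (i1 := i1) (i2 := i2)).
exact: (degree_not_graph_wide d_gt1 evC lt_s m_miss).
Qed.
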